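(* Let $n\geq5$ and let $(s,\pi,L,U)$ be an admissible quadruple. The basis encoded by $(s,\pi,L,U)$ is feasible if and only if the following conditions are satisfied: (i) $|U|=\lfloor(n-2)/2\rfloor$ and $|L|=\lceil(n-2)/2\rceil$; (ii) $\pi(s)\in U$; (iii) for every $i\in[n]\setminus\{s,s-1\}$, $\displaystyle\alpha_{s1}+\sum_{j\in I(i)}\alpha_{j1}\geq0$.
   Context: Let $K_n$ be the complete digraph on $V=[n]$ (all arcs $(i,j)$, $i\neq j$). For $\beta\in(0,1)$, $\mathcal{WH}_\beta(K_n)$ is the set of $(x,y)$, $x=(x_{ij})_{i\neq j}$, $y=(y_i)_{i\neq1}$, with (1) $\sum_{j\neq1}x_{1j}-\beta\sum_{j\neq1}x_{j1}=1-\beta^n$; (2) $\sum_{j\neq i}x_{ij}-\beta\sum_{j\neq i}x_{ji}=0$ for $i\in V\setminus\{1\}$; (3) $\sum_{j\neq1}x_{1j}=1$; (4) $\sum_{j\neq i}x_{ij}-y_i=\beta^{n-1}$ for $i\in V\setminus\{1\}$; (5) $0\leq y_i\leq\beta-\beta^{n-1}$ for $i\in V\setminus\{1\}$; (6) $x_{ij}\geq0$ for $i\neq j$. Indices $i\pm1,i\pm2$ are taken modulo $n$ in $[n]$. An admissible quadruple $(s,\pi,L,U)$ consists of a node $s\in\{2,\dots,n\}$, a fixed-point free permutation $\pi$ of $[n]$ such that $\pi(i)=i+1$ if and only if $i=s-1$, and a partition $[n]=\{1,s\}\cup L\cup U$ (disjoint from $\{1,s\}$; $L,U$ possibly empty).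 It encodes the basis $(B,L,U)$ with basic variables $y_s$, $x_{i\,\pi(i)}$ for $i\in[n]$, and $x_{i\,\pi(i-1)}$ for $i\in[n]\setminus\{s\}$. The associated basic solution is the unique solution of (1)–(4) in which all non-basic $x$-variables are $0$, $y_i=0$ for $i\in L$ and $y_i=\beta-\beta^{n-1}$ for $i\in U$. The basis is called feasible if this solution satisfies (5) and (6) for all $\beta<1$ sufficiently close to $1$ (feasibility does not depend on $\beta$ for $\beta$ sufficiently close to $1$). Put $R=\{1\}$ and, for $P,Q\in\{L,U,R\}$, $W_{PQ}=\{i\in[n]\setminus\{s\}: i\in P,\ \pi(i)\in Q\}$; these sets partition $[n]\setminus\{s,s-1\}$. For $i\in[n]\setminus\{s,s-1\}$ set $\alpha_{i1}=1$ if $i\in W_{UU}\cup W_{LL}$; $\alpha_{i1}=3-n$ if $i\in W_{UL}$; $\alpha_{i1}=n-1$ if $i\in W_{LU}$; $\alpha_{i1}=2-n$ if $i\in W_{UR}\cup W_{RL}$; $\alpha_{i1}=0$ if $i\in W_{LR}\cup W_{RU}$. Also $\alpha_{s1}=n/2$ if $n$ is even and $\alpha_{s1}=1$ if $n$ is odd. For $i\in[n]\setminus\{s,s-1\}$, $I(i)=\{s+1,\dots,i\}$ if $s+1\leq i\leq n$, and $I(i)=\{s+1,\dots,n,1,2,\dots,i\}$ if $1\leq i\leq s-2$. *)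

(* Defs.v *)
From mathcomp Require Import all_boot all_order all_algebra all_fingroup.
From mathcomp Require Import all_classical all_reals.
From mathcomp Require Import topology normedtype.

Set Implicit Arguments.
Unset Strict Implicit.
Unset Printing Implicit Defensive.

Import Order.TTheory GRing.Theory Num.Theory.
Import numFieldNormedType.Exports.

(* The number of nodes is n = m.+1; node k of [n] = {1, ..., n} is the ordinal
   of value k - 1 in 'I_n, so node 1 is ord0. Indices modulo n are taken with
   ordS and ord_pred. *)

Local Open Scope ring_scope.

Section Polytope.
Variables (R : realType) (m : nat).
Local Notation n := m.+1.

(* x_ij is only meant for i != j and y_i only for i != 1. The variables are
   stored as total functions; basic_solution sets the unused entries x_ii and
   y_1 to 0, and the constraints do not mention them. *)
Definition point : Type := ('M[R]_n * {ffun 'I_n -> R})%type.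

Definition WH_equations (b : R) (p : point) : Prop :=
  let: (x, y) := p in
  [/\ \sum_(j | j != ord0) x ord0 j - b * \sum_(j | j != ord0) x j ord0
        = 1 - b ^+ n,
      forall i, i != ord0 ->
        \sum_(j | j != i) x i j - b * \sum_(j | j != i) x j i = 0,
      \sum_(j | j != ord0) x ord0 j = 1
    & forall i, i != ord0 ->
        \sum_(j | j != i) x i j - y i = b ^+ n.-1].

(* WH_beta(K_n) is the set of points satisfying WH_equations and WH_bounds. *)
Definition WH_bounds (b : R) (p : point) : Prop :=
  let: (x, y) := p in
  (forall i, i != ord0 -> 0 <= y i <= b - b ^+ n.-1) /\
  (forall i j, i != j -> 0 <= x i j).

End Polytope.

Section Basis.
Variables (m : nat).
Local Notation n := m.+1.
Variables (s : 'I_n) (pi : {perm 'I_n}) (L U : {set 'I_n}).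

Definition admissible : Prop :=
  [/\ s != ord0,
      forall i, pi i != i,
      forall i, pi i = ordS i <-> i = ord_pred s
    & [/\ [set ord0; s] :|: L :|: U = [set: 'I_n],
          [disjoint [set ord0; s] & L],
          [disjoint [set ord0; s] & U]
        & [disjoint L & U]]].

Definition basic_arc (i j : 'I_n) : bool :=
  (j == pi i) || (i != s) && (j == pi (ord_pred i)).

Definition basic_solution (R : realType) (b : R) (p : point R m) : Prop :=
  let: (x, y) := p in
  [/\ WH_equations b p,
      forall i j, i != j -> ~~ basic_arc i j -> x i j = 0,
      forall i, i \in L -> y i = 0,
      forall i, i \in U -> y i = b - b ^+ n.-1
    & (forall i, x i i = 0) /\ y ord0 = 0].

Definition feasible (R : realType) : Prop :=
  \forall b \near ((1 : R)^'-)%classic,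
    exists2 p : point R m, unique (basic_solution b) p & WH_bounds b p.

Definition W (P Q : {set 'I_n}) : {set 'I_n} :=
  [set i | [&& i != s, i \in P & pi i \in Q]].

(* alpha i is alpha_{i1}. The last branch is W_LR and W_RU when i is neither s
   nor s - 1; the value at s - 1 is never used. *)
Definition alpha (i : 'I_n) : int :=
  let Rt := [set ord0] in
  if i == s then (if odd n then 1 else n./2%:Z)
  else if i \in W U U :|: W L L then 1
  else if i \in W U L then 3%:Z - n%:Z
  else if i \in W L U then n%:Z - 1
  else if i \in W U Rt :|: W Rt L then 2%:Z - n%:Z
  else 0.

(* The cyclic interval {s+1, ..., i}, for i distinct from s and s - 1. *)
Definition cyc_interval (i : 'I_n) : {set 'I_n} :=
  if (s < i)%N then [set j : 'I_n | (s < j <= i)%N]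
  else [set j : 'I_n | (s < j)%N || (j <= i)%N].

End Basis.

(* Main.v *)
Require Import Defs.
From mathcomp Require Import all_boot all_order all_algebra all_fingroup.
From mathcomp Require Import all_classical all_reals.
From mathcomp Require Import topology normedtype derive.
From mathcomp Require Import ring lra zify.

(** The basic arcs link the sending and receiving sides of the nodes in a
    single path.  Node [i] sends flow only to [pi i] and to [pi (i-1)], and node
    [pi i] receives flow only from [i] and [i+1].  The equations of the polytope
    prescribe the outflow and the inflow of every node: 1 and [b^m] at node 1,
    [b^m] and [b^(m-1)] on [L], [b] and 1 on [U] (with [m = n - 1]), and those
    of [s] follow from their ratio [b] and from total inflow = total outflow.
    Node [s] has a single outgoing basic arc, so going round the cycle from [s]
    determines all flows: the flow on the arc from [i+1] to [pi i] is the
    partial sum [excess i] of [inflow (pi j) - outflow j] for [j] from [s] to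
    [i], and the other arc of node [i+1] carries the rest.  Hence the basic
    solution exists, is unique for [0 < b < 1], and its entries are explicit
    polynomials in [b].

    Feasibility is thus about signs of polynomials to the left of 1.  At
    [b = 1] all inflows and outflows are 1, so the flow on every arc
    [(i, pi i)] tends to 1, whereas each [excess i], and the two slacks of the
    bounds on [y_s], vanish at 1.  Their signs are those of the opposite of
    their derivatives at 1, as long as these do not vanish.  For the two slacks
    the derivatives compare [2 #|L|] with [n - 3] and [n - 1]; once [L] has the
    right size, the derivative of [excess s] is nonpositive exactly when
    [pi s] lies in [U], and then the derivative of every other [excess i] is
    minus the sum of the alphas.

    It remains to decide the ties.  When [f'(1) = 0], the second derivative
    equals [curv f = f''(1) - (n - 2) f'(1)], and this linear functional is
    convenient: it sends ['X^k] to [k (k - m)], so that it vanishes on 1 and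
    ['X^m] and takes the same value [-(n - 2)] on ['X] and ['X^(m-1)].
    Consequently each node of the partial sum contributes [-(n - 2)] if its
    image lies in [L], [n - 2] if it lies itself in [U], and nothing otherwise,
    while [-outflow s] contributes [(n - 2) (n (n - 1) / 6 - #|U|)].  Therefore
    [curv (excess i) >= (n - 2) (n (n - 1) / 6 - (n - 2)) > 0], so that a tie
    in the alpha condition is always feasible (lemma [curv_excess_gt0]).  For
    the slacks of [y_s] the sign of [curv] makes a tie admissible on the upper
    bound and inadmissible on the lower one, which is why [2 #|L| = n - 1], and
    not [2 #|L| = n - 3], is the right value for odd [n]. *)

Set Implicit Arguments.
Unset Strict Implicit.
Unset Printing Implicit Defensive.

Import Order.TTheory GRing.Theory Num.Theory.
Import numFieldNormedType.Exports.

Local Open Scope ring_scope.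

(** * Signs of polynomials to the left of 1 *)

Section Sign.
Variable R : realType.
Implicit Types f g : {poly R}.

Lemma at_left1_itv : \forall b \near ((1 : R)^'-)%classic, 0 < b < 1.
Proof.
near=> b; apply/andP; split; last by near: b; exact: nbhs_left_lt.
near: b; apply: nbhs_left_gt; exact: ltr01.
Unshelve. all: by end_near. Qed.

Lemma horner_pos_at_left1 f : 0 < f.[1] ->
  \forall b \near ((1 : R)^'-)%classic, 0 < f.[b].
Proof.
move=> f1.
have h : (f.[b] @[b --> (1 : R)^'-] --> f.[1])%classic.
  by apply: cvg_at_left_filter; exact: continuous_horner.
exact: (cvgr_gt _ h).
Qed.

(** Dividing by ['X - 1] turns the derivative at 1 into a value at 1; there
    continuity suffices. *)
Lemma horner_factor1 f : f.[1] = 0 ->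
  exists g, f = g * ('X - 1%:P) /\ f^`().[1] = g.[1].
Proof.
move=> f1; have /factor_theorem[g fE] : root f 1 by apply/rootP.
exists g; split=> //.
by rewrite fE derivM derivXsubC !hornerE subrr mulr0 add0r.
Qed.

Lemma horner_pos_at_left1_deriv f : f.[1] = 0 -> f^`().[1] < 0 ->
  \forall b \near ((1 : R)^'-)%classic, 0 < f.[b].
Proof.
move=> /horner_factor1[g [-> ->]] g1.
have : 0 < (- g).[1] by rewrite hornerN oppr_gt0.
move=> /horner_pos_at_left1 gpos.
near=> b.
have /andP[_ b1] : 0 < b < 1 by near: b; exact: at_left1_itv.
have : 0 < (- g).[b] by near: b.
rewrite !hornerE; nra.
Unshelve. all: by end_near. Qed.

Lemma horner_pos_at_left1_deriv2 f :
    f.[1] = 0 -> f^`().[1] = 0 -> 0 < f^`()^`().[1] ->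
  \forall b \near ((1 : R)^'-)%classic, 0 < f.[b].
Proof.
move=> /horner_factor1[g [fE ->]] /horner_factor1[h [gE g'1]].
have -> : f^`()^`().[1] = h.[1] *+ 2.
  rewrite -g'1 fE derivM derivXsubC mulr1 derivD derivM derivXsubC mulr1.
  by rewrite !hornerE subrr; ring.
rewrite pmulrn_lgt0 // => /horner_pos_at_left1 hpos.
near=> b.
have /andP[_ b1] : 0 < b < 1 by near: b; exact: at_left1_itv.
have : 0 < h.[b] by near: b.
rewrite fE gE !hornerE -mulrA => hb.
by rewrite mulr_gt0 // -expr2 exprn_even_gt0 //= subr_eq0 lt_eqF.
Unshelve. all: by end_near. Qed.

Lemma near_le0_gt0_absurd f :
  (\forall b \near ((1 : R)^'-)%classic, 0 <= f.[b]) ->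
  (\forall b \near ((1 : R)^'-)%classic, 0 < (- f).[b]) -> False.
Proof.
move=> h1 h2.
have [b [/= fb]] := filter_ex (filterI h1 h2).
by rewrite hornerN oppr_gt0 => /(le_lt_trans fb); rewrite ltxx.
Qed.

(** A polynomial that vanishes at 1 decreases towards 0 when its derivative
    is negative; the hypothesis on the second derivative makes it also
    nonnegative in case of a tie. *)
Lemma horner_ge0_at_left1 f :
    f.[1] = 0 -> (f^`().[1] = 0 -> 0 < f^`()^`().[1]) ->
  (\forall b \near ((1 : R)^'-)%classic, 0 <= f.[b]) <-> f^`().[1] <= 0.
Proof.
move=> f1 f2; split=> [f_ge0|]; last first.
  rewrite le_eqVlt => /orP[/eqP f'1|f'1].
    by have := horner_pos_at_left1_deriv2 f1 f'1 (f2 f'1); apply: filterS => b /ltW.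
  by have := horner_pos_at_left1_deriv f1 f'1; apply: filterS => b /ltW.
rewrite leNgt; apply/negP => f'1.
apply: (near_le0_gt0_absurd f_ge0); apply: horner_pos_at_left1_deriv.
  by rewrite hornerN f1 oppr0.
by rewrite derivN hornerN oppr_lt0.
Qed.

(** The opposite convexity in case of a tie makes the polynomial negative, so
    that the condition on the derivative becomes strict. *)
Lemma horner_ge0_at_left1_strict f :
    f.[1] = 0 -> (f^`().[1] = 0 -> f^`()^`().[1] < 0) ->
  (\forall b \near ((1 : R)^'-)%classic, 0 <= f.[b]) <-> f^`().[1] < 0.
Proof.
move=> f1 f2; split=> [f_ge0|]; last first.
  by move=> /(horner_pos_at_left1_deriv f1); apply: filterS => b /ltW.
rewrite ltNge le_eqVlt; apply/negP => /orP[/eqP/esym f'1|f'1];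
    apply: (near_le0_gt0_absurd f_ge0).
  by apply: horner_pos_at_left1_deriv2;
    rewrite ?derivN ?hornerN ?f1 ?f'1 ?oppr0 ?oppr_gt0 ?f2.
by apply: horner_pos_at_left1_deriv; rewrite ?derivN hornerN ?f1 ?oppr0 ?oppr_lt0.
Qed.

End Sign.

(** * Cyclic arcs and cyclic partial sums *)

Lemma val_ordS m (i : 'I_m.+1) : ordS i = (if i == m :> nat then 0%N else i.+1) :> nat.
Proof.
rewrite /=; have := ltn_ord i; case: eqP => [-> _|]; first exact: modnn.
by move=> *; rewrite modn_small //; lia.
Qed.

Section Arc.
Variables (m : nat) (s : 'I_m.+1).
Hypothesis s_neq0 : s != ord0.

(** The cyclic interval [{s, s+1, ..., i}].  Unlike [cyc_interval] it contains
    [s], so that it is the singleton [{s}] at [i = s] and grows by one element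
    at each step until it is the whole cycle at [s - 1]. *)
Definition closed_arc (i : 'I_m.+1) : {set 'I_m.+1} :=
  [set j : 'I_m.+1 |
    if (s <= i)%N then (s <= j <= i)%N else (s <= j)%N || (j <= i)%N].

Lemma val_ord_pred_s : ord_pred s = s.-1 :> nat.
Proof.
rewrite /=; case: s s_neq0 => -[|k] lt_k //= _.
by rewrite modnDr modn_small // ltnW.
Qed.

Lemma neq_ord_pred_s (i : 'I_m.+1) : (i != ord_pred s) = (i != s.-1 :> nat).
Proof. by rewrite -val_eqE /= -[in RHS]val_ord_pred_s. Qed.

Lemma arc_start : closed_arc s = [set s].
Proof. by apply/setP=> j; rewrite !inE leqnn -eqn_leq eq_sym val_eqE. Qed.

Lemma arc_end : closed_arc (ord_pred s) = [set: 'I_m.+1].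
Proof.
apply/setP=> j; rewrite !inE val_ord_pred_s.
have : s != 0 :> nat by [].
by case: ifP; lia.
Qed.

Lemma end_notin_arc i : i != ord_pred s -> ord_pred s \notin closed_arc i.
Proof.
rewrite neq_ord_pred_s inE val_ord_pred_s.
have : s != 0 :> nat by []. have := ltn_ord s; have := ltn_ord i.
by case: ifP; lia.
Qed.

Lemma arc_step i : i != s ->
  closed_arc i = i |: closed_arc (ord_pred i) /\ i \notin closed_arc (ord_pred i).
Proof.
rewrite -[i]ord_predK; set k := ord_pred i; rewrite ordSK.
rewrite -(inj_eq (@ord_pred_inj _)) ordSK neq_ord_pred_s => ks.
have s0 : s != 0 :> nat by [].
have := ltn_ord s; have := ltn_ord k.
split; last by rewrite inE val_ordS; case: ifP; case: ifP; lia.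
have jE j : (j == ordS k) = (j == (if k == m :> nat then 0 else k.+1)%N :> nat).
  by rewrite -val_ordS; apply/eqP/eqP => [->|/val_inj].
apply/setP=> j; rewrite !inE jE val_ordS.
by have := ltn_ord j; repeat case: ifP; lia.
Qed.

Lemma arc_cyc_interval i : i != s ->
  closed_arc i = s |: cyc_interval s i /\ s \notin cyc_interval s i.
Proof.
rewrite -val_eqE /= => si.
split; last by rewrite /cyc_interval; case: ifP; rewrite inE; lia.
apply/setP=> j; rewrite in_setU1 -[j == s]val_eqE /cyc_interval [in LHS]inE /=.
by case: ifP; case: ifP; rewrite inE; lia.
Qed.

Section ArcSum.
Variables (V : zmodType) (g : 'I_m.+1 -> V).

Definition arc_sum i := \sum_(j in closed_arc i) g j.

Lemma arc_sum_step i : i != s -> arc_sum i = arc_sum (ord_pred i) + g i.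
Proof. by move=> /arc_step[arcE ni]; rewrite /arc_sum arcE big_setU1 // addrC. Qed.

Lemma arc_sum_end : arc_sum (ord_pred s) = \sum_j g j.
Proof. by rewrite /arc_sum arc_end; apply: eq_bigl => j; rewrite inE. Qed.

(** Without the balance assumption the recurrence fails exactly at [i = s],
    where the sum starts afresh instead of continuing from the full cycle. *)
Lemma arc_sum_balanced i : \sum_j g j = 0 ->
  arc_sum i = arc_sum (ord_pred i) + g i.
Proof.
move=> g0; have [->|] := eqVneq i s; last exact: arc_sum_step.
by rewrite arc_sum_end g0 add0r /arc_sum arc_start big_set1.
Qed.

Lemma arc_sum_cyc i : i != s ->
  arc_sum i = g s + \sum_(j in cyc_interval s i) g j.
Proof. by move=> /arc_cyc_interval[arcE ns]; rewrite /arc_sum arcE big_setU1. Qed.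

(** A cyclic difference equation has a solution only if its right-hand side
    sums to zero, and it is then determined by one value. *)
Lemma arc_sum_unique (c : 'I_m.+1 -> V) :
    c s = 0 -> (forall i, c (ordS i) = c i + g i) ->
  \sum_j g j = 0 /\ forall i, c i = arc_sum (ord_pred i).
Proof.
move=> cs cS.
have g0 : \sum_j g j = 0.
  have : \sum_j c (ordS j) = \sum_j c j + \sum_j g j.
    by rewrite -big_split; apply: eq_bigr => j _; rewrite cS.
  rewrite -(reindex_inj (F := c) (P := predT) (@ordS_inj _)) => /esym/eqP.
  by rewrite -subr_eq0 addrAC subrr add0r => /eqP.
split=> // i.
(* Both sides satisfy the same recurrence and vanish at s, hence they agree at
   every node reached from s. *)
pose d i := c i - arc_sum (ord_pred i).
suff d0 k : d (iter k (@ordS _) s) = 0.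
  suff [k ->] : exists k, i = iter k (@ordS _) s.
    by have := d0 k => /eqP; rewrite subr_eq0 => /eqP.
  exists (i + (m.+1 - s))%N.
  have iterE k : iter k (@ordS _) s = ((s + k) %% m.+1)%N :> nat.
    elim: k => [|k IH]; first by rewrite addn0 modn_small.
    by rewrite iterS /= IH -addn1 modnDml addn1 addnS.
  apply/val_inj; rewrite /= iterE.
  have -> : (s + (i + (m.+1 - s)) = i + m.+1)%N by have := ltn_ord s; lia.
  by rewrite modnDr modn_small.
elim: k => [|k IH]; first by rewrite /d /= cs arc_sum_end g0 subr0.
rewrite iterS /d cS ordSK arc_sum_balanced // opprD addrACA subrr addr0.
exact: IH.
Qed.

End ArcSum.
End Arc.

(** * The basic solution *)

Section Flow.
Variables (m : nat) (V : zmodType) (pi : {perm 'I_m.+1}).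
Implicit Types a c : 'I_m.+1 -> V.

(** [a i] is the flow on [(i, pi i)] and [c i] the flow on
    [(i, pi (i-1))].  Node [s] has no second basic arc; instead of a case
    distinction, [c s = 0] is required where it matters, the would-be arc being
    the loop [(s, s)]. *)
Definition flow a c : 'M[V]_m.+1 :=
  \matrix_(i, j) ((if j == pi i then a i else 0)
                  + (if j == pi (ord_pred i) then c i else 0)).

Lemma flow_out a c i : \sum_j flow a c i j = a i + c i.
Proof.
under eq_bigr do rewrite mxE.
by rewrite big_split /= -!big_mkcond /= !big_pred1_eq.
Qed.

Lemma flow_in a c i : \sum_j flow a c j (pi i) = a i + c (ordS i).
Proof.
under eq_bigr do rewrite mxE !(inj_eq perm_inj).
rewrite big_split /= -!big_mkcond /=; congr (_ + _).
  by rewrite (big_pred1 i) // => j; rewrite eq_sym.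
rewrite (big_pred1 (ordS i)) // => j.
by rewrite -(inj_eq (@ordS_inj _)) ord_predK eq_sym.
Qed.

End Flow.

Section Admissible.
Variables (m : nat) (s : 'I_m.+1) (pi : {perm 'I_m.+1}) (L U : {set 'I_m.+1}).
Hypothesis hadm : admissible s pi L U.

Lemma s_neq0 : s != ord0. Proof. by case: hadm. Qed.

Lemma m_gt0 : (0 < m)%N.
Proof. by have := s_neq0; have := ltn_ord s; rewrite -val_eqE /=; lia. Qed.

Lemma pi_neq i : pi i != i. Proof. by case: hadm. Qed.

Lemma pi_end : pi (ord_pred s) = s.
Proof.
by case: hadm => _ _ h _; have [_ ->] := h (ord_pred s); rewrite ?ord_predK.
Qed.

Lemma pi_neq_ordS i : i != ord_pred s -> ordS i != pi i.
Proof. by case: hadm => _ _ h _; apply: contra_neq => /esym /h. Qed.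

Lemma pi_eq_start i : (pi i == s) = (i == ord_pred s).
Proof. by rewrite -[in LHS]pi_end (inj_eq perm_inj). Qed.

Lemma ord_pred_neq (i : 'I_m.+1) : ord_pred i != i.
Proof.
apply/eqP => /(congr1 (@ordS _)); rewrite ord_predK => /(congr1 val) /=.
have := val_ordS i; rewrite /= => ->.
by have := m_gt0; case: eqP; lia.
Qed.

Lemma mem_L i : (i \in L) = [&& i != ord0, i != s & i \notin U].
Proof.
case: hadm => _ _ _ [/setP/(_ i) c /pred0P/(_ i) dL /pred0P/(_ i) dU /pred0P/(_ i) d].
by move: c dL dU d; rewrite /= !inE; do 4?case: (_ == _) || case: (_ \in _).
Qed.

Lemma U_not_special i : i \in U -> (i != ord0) && (i != s).
Proof.
case: hadm => _ _ _ [_ _ /pred0P/(_ i) + _] iU; rewrite /= !inE iU.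
by do 2?case: (_ == _).
Qed.

(** The form in which the partition of the nodes is used. *)
Lemma sum_nodes (V : nmodType) (f : 'I_m.+1 -> V) :
  \sum_i f i = f ord0 + f s + \sum_(i in L) f i + \sum_(i in U) f i.
Proof.
rewrite (bigD1 ord0) //= (bigD1 s) ?s_neq0 //= -!addrA; congr (_ + (_ + _)).
rewrite (bigID [in U]) /= addrC; congr (_ + _); apply: eq_bigl => i.
  by rewrite mem_L andbA.
case: hadm => _ _ _ [_ _ /pred0P/(_ i) dU _]; move: dU; rewrite /= !inE.
by do 3?case: (_ == _) || case: (_ \in _).
Qed.

Lemma card_LU : (#|L| + #|U|).+1 = m.
Proof.
have := sum_nodes (fun=> 1%N); rewrite !sum1_card card_ord => cardE.
have {cardE} : m.+1 = (1 + 1 + #|L| + #|U|)%N by exact: cardE.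
by lia.
Qed.

(** Both sides say that [L] has half of the [n - 2] nodes other than 1 and
    [s], with the rounding upwards. *)
Lemma card_condition :
  (m < #|L|.*2 + 2)%N && (#|L|.*2 <= m)%N
  <-> #|U| = (m.+1 - 2)./2 /\ #|L| = uphalf (m.+1 - 2).
Proof. by have := card_LU; split=> [?|[? ?]]; [split; lia|lia]. Qed.

End Admissible.

Section Basis.
Variables (R : realType) (m : nat).
Variables (s : 'I_m.+1) (pi : {perm 'I_m.+1}) (L U : {set 'I_m.+1}).
Hypothesis hadm : admissible s pi L U.

(** Flow into and out of each node in the basic solution, as polynomials in
    [b].  Since [outflow s = 'X * inflow s], the value at [s] times [1 - 'X] is
    what balances the totals over the other nodes; the geometric sum is the
    quotient of [1 - 'X^m] at node 1 by [1 - 'X]. *)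
Definition inflow (i : 'I_m.+1) : {poly R} :=
  if i == ord0 then 'X^m
  else if i == s then \sum_(k < m) 'X^k - 'X^(m.-1) *+ #|L| - 1 *+ #|U|
  else if i \in U then 1 else 'X^(m.-1).

Definition outflow (i : 'I_m.+1) : {poly R} := if i == ord0 then 1 else 'X * inflow i.

(** The flow on the arc from [i+1] to [pi i], see [basis_point]. *)
Definition excess (i : 'I_m.+1) : {poly R} :=
  arc_sum s (fun j => inflow (pi j) - outflow j) i.

Lemma inflow_L i : i \in L -> inflow i = 'X^(m.-1).
Proof. by rewrite (mem_L hadm) /inflow => /and3P[/negPf-> /negPf-> /negPf->]. Qed.

Lemma inflow_U i : i \in U -> inflow i = 1.
Proof.
by move=> iU; rewrite /inflow iU; have /andP[/negPf-> /negPf->] := U_not_special hadm iU.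
Qed.

Lemma outflow_L i : i \in L -> outflow i = 'X^m.
Proof.
move=> iL; rewrite /outflow inflow_L // -exprS prednK ?(m_gt0 hadm) //.
by move: iL; rewrite (mem_L hadm) => /and3P[/negPf->].
Qed.

Lemma outflow_U i : i \in U -> outflow i = 'X.
Proof.
by move=> iU; rewrite /outflow inflow_U // mulr1; have /andP[/negPf->] := U_not_special hadm iU.
Qed.

Lemma inflow_s : inflow s = \sum_(k < m) 'X^k - 'X^(m.-1) *+ #|L| - 1 *+ #|U|.
Proof. by rewrite /inflow (negPf (s_neq0 hadm)) eqxx. Qed.

Lemma outflow_s : outflow s = 'X * inflow s.
Proof. by rewrite /outflow (negPf (s_neq0 hadm)). Qed.

Lemma sum_inflow_outflow : \sum_j inflow j = \sum_j outflow j.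
Proof.
have inflow_0 : inflow ord0 = 'X^m by rewrite /inflow eqxx.
have outflow_0 : outflow ord0 = 1 by rewrite /outflow eqxx.
rewrite !(sum_nodes hadm) inflow_0 outflow_0 outflow_s inflow_s.
rewrite (eq_bigr _ inflow_L) (eq_bigr _ inflow_U).
rewrite (eq_bigr _ outflow_L) (eq_bigr _ outflow_U).
rewrite !sumr_const.
have XmE : 'X^m = 'X * 'X^(m.-1) :> {poly R} by rewrite -exprS prednK ?(m_gt0 hadm).
have := subrX1 ('X : {poly R}) m; rewrite XmE.
move: (\sum_(k < m) _) ('X^(m.-1)) => S Y geomE.
apply/eqP; rewrite -subr_eq0; apply/eqP.
transitivity (('X * Y - 1) - ('X - 1) * S); first ring.
by rewrite geomE subrr.
Qed.

Lemma balance : \sum_j (inflow (pi j) - outflow j) = 0.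
Proof.
rewrite big_split sumrN /= -sum_inflow_outflow.
rewrite -(reindex_inj (F := inflow) (P := predT) perm_inj).
by rewrite subrr.
Qed.

Lemma excess_step i : excess i = excess (ord_pred i) + (inflow (pi i) - outflow i).
Proof. by rewrite /excess arc_sum_balanced ?balance ?(s_neq0 hadm). Qed.

Lemma excess_end : excess (ord_pred s) = 0.
Proof. by rewrite /excess arc_sum_end ?balance ?(s_neq0 hadm). Qed.

Section Solution.
Variable b : R.
Hypothesis b01 : 0 < b < 1.

Let b_neq0 : b != 0. Proof. by case/andP: b01 => /lt0r_neq0. Qed.
Let b_neq1 : 1 - b != 0.
Proof. by rewrite subr_eq0 gt_eqF //; case/andP: b01. Qed.

Definition basis_point : Defs.point R m :=
  (flow pi (fun i => (outflow i).[b] - (excess (ord_pred i)).[b])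
           (fun i => (excess (ord_pred i)).[b]),
   [ffun i => if i == ord0 then 0 else (outflow i).[b] - b ^+ m]).

(** The equations of the polytope only involve the inflows and outflows of
    the nodes. *)
Lemma WH_equations_outflow_inflow (x : 'M[R]_m.+1) (y : {ffun 'I_m.+1 -> R}) :
    (forall i, x i i = 0) ->
  WH_equations b (x, y) <->
  [/\ \sum_j x ord0 j = 1,
      \sum_j x j ord0 = b ^+ m,
      forall i, i != ord0 -> \sum_j x i j = b * \sum_j x j i
    & forall i, i != ord0 -> y i = \sum_j x i j - b ^+ m].
Proof.
move=> x0.
have outE i : \sum_(j | j != i) x i j = \sum_j x i j.
  by rewrite [RHS](bigD1 i) //= x0 add0r.
have inE i : \sum_(j | j != i) x j i = \sum_j x j i.
  by rewrite [RHS](bigD1 i) //= x0 add0r.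
split=> [[h1 h2 h3 h4]|[h1 h2 h3 h4]].
  move: h1 h3; rewrite outE inE => h1 h3; split => //.
  - apply: (mulfI b_neq0); rewrite -exprS.
    by move: h1; rewrite h3 => /addrI /oppr_inj.
  - by move=> i /h2; rewrite outE inE => /eqP; rewrite subr_eq0 => /eqP.
  - by move=> i /h4 <-; rewrite outE opprB addrCA subrr addr0.
split; rewrite ?outE ?inE ?h1 ?h2 -?exprS //.
- by move=> i /h3; rewrite outE inE => ->; rewrite subrr.
- by move=> i /h4 ->; rewrite outE opprB addrCA subrr addr0.
Qed.

Lemma basic_solution_flow p : basic_solution s pi L U b p ->
  p.1 = flow pi (fun i => p.1 i (pi i)) (fun i => p.1 i (pi (ord_pred i))).
Proof.
case: p => x y [_ nb _ _ [x0 _]] /=.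
apply/matrixP => i j; rewrite mxE.
have [->|jpi] := eqVneq j (pi i).
  by rewrite (inj_eq perm_inj) eq_sym (negPf ((ord_pred_neq hadm) i)) addr0.
have [->|jpi'] := eqVneq j (pi (ord_pred i)); first by rewrite add0r.
have [<-|ij] := eqVneq i j; first by rewrite x0 addr0.
by rewrite nb ?addr0 // /basic_arc (negPf jpi) (negPf jpi') andbF.
Qed.

Lemma horner_outflow_neq0 i : i != ord0 -> (outflow i).[b] = b * (inflow i).[b].
Proof. by rewrite /outflow => /negPf->; rewrite hornerM hornerX. Qed.

Lemma basis_point_out i : \sum_j basis_point.1 i j = (outflow i).[b].
Proof. by rewrite flow_out subrK. Qed.

Lemma basis_point_in i : \sum_j basis_point.1 j i = (inflow i).[b].
Proof.
rewrite -[i](permKV pi); set k := (pi^-1)%g i.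
by rewrite flow_in ordSK (excess_step k) !(hornerD, hornerN); ring.
Qed.

(** Since the total excess is zero, the recurrence [excess_step] also holds
    at [s]; it is the equation for the inflow of [pi i]. *)
Lemma basis_point_basic : basic_solution s pi L U b basis_point.
Proof.
have x0 i : basis_point.1 i i = 0.
  rewrite mxE ![i == _]eq_sym (negPf ((pi_neq hadm) i)) add0r.
  case: eqP => // pi_i.
  (* The loop (i, pi (i-1)) only occurs at s, where its coefficient is the
     total excess. *)
  suff -> : i = s by rewrite excess_end horner0.
  apply/eqP/negPn/negP => ins.
  have := @pi_neq_ordS _ _ _ _ _ hadm (ord_pred i).
  by rewrite pi_i ord_predK (inj_eq (@ord_pred_inj _)) eqxx => /(_ ins).
split; last by split=> //; rewrite ffunE eqxx.
- apply/WH_equations_outflow_inflow => //; split.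
  + by rewrite basis_point_out /outflow eqxx hornerC.
  + by rewrite basis_point_in /inflow eqxx hornerXn.
  + by move=> i i0; rewrite basis_point_out basis_point_in horner_outflow_neq0.
  + by move=> i i0; rewrite basis_point_out ffunE (negPf i0).
- move=> i j ij; rewrite /basic_arc negb_or negb_and negbK => /andP[/negPf jpi hj].
  rewrite mxE jpi add0r; have [jE|//] := eqVneq j (pi (ord_pred i)).
  by move: hj; rewrite jE eqxx orbF => /eqP->; rewrite excess_end horner0.
- move=> i iL; rewrite ffunE outflow_L // hornerXn subrr.
  by case: ifP.
- move=> i iU; rewrite ffunE outflow_U // hornerX.
  by have /andP[/negPf->] := U_not_special hadm iU.
Qed.

(** The equations determine inflow and outflow of all nodes but [s] directly,
    and those of [s] by [inflow = outflow] in total together with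
    [outflow s = b * inflow s], where [b != 1] is used.  The flows on the second
    arcs then solve a cyclic difference equation. *)
Lemma basic_solution_unique p : basic_solution s pi L U b p -> p = basis_point.
Proof.
move=> bp; have flowE := basic_solution_flow bp.
case: p bp flowE => x y bp /= flowE.
have [/WH_equations_outflow_inflow wh nb yL yU [x0 y0]] := bp.
have {wh} [o0 w0 ow yE] := wh x0.
pose o i := \sum_j x i j; pose w i := \sum_j x j i.
have wL i : i \in L -> w i = (inflow i).[b].
  move=> iL; have i0 : i != ord0 by move: iL; rewrite (mem_L hadm) => /and3P[].
  apply: (mulfI b_neq0); rewrite -ow // -horner_outflow_neq0 // outflow_L // hornerXn.
  by have := yE _ i0; rewrite yL // => /esym/eqP; rewrite subr_eq0 => /eqP.
have wU i : i \in U -> w i = (inflow i).[b].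
  move=> iU; have /andP[i0 _] := U_not_special hadm iU.
  apply: (mulfI b_neq0); rewrite -ow // -horner_outflow_neq0 // outflow_U // hornerX.
  by have := yE _ i0; rewrite yU // => /addIr ->.
have w_0 : w ord0 = (inflow ord0).[b] by rewrite /inflow eqxx hornerXn.
have o_0 : o ord0 = (outflow ord0).[b] by rewrite /outflow eqxx hornerC.
have oE i : i != ord0 -> w i = (inflow i).[b] -> o i = (outflow i).[b].
  by move=> i0 wi; rewrite /o ow // horner_outflow_neq0 // -wi.
have oL i : i \in L -> o i = (outflow i).[b].
  by move=> iL; apply: oE (wL _ iL); move: iL; rewrite (mem_L hadm) => /and3P[].
have oU i : i \in U -> o i = (outflow i).[b].
  by move=> iU; apply: oE (wU _ iU); have /andP[] := U_not_special hadm iU.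
have ws : w s = (inflow s).[b].
  have total : \sum_i w i = \sum_i o i by rewrite /w exchange_big.
  have := congr1 (horner^~ b) sum_inflow_outflow; rewrite /= !horner_sum.
  move: total; rewrite !(sum_nodes hadm) w_0 o_0 (eq_bigr _ wL) (eq_bigr _ wU).
  rewrite (eq_bigr _ oL) (eq_bigr _ oU) (_ : o s = b * w s); last exact: ow (s_neq0 hadm).
  rewrite (horner_outflow_neq0 (s_neq0 hadm)) => e1 e2; apply: (mulfI b_neq1).
  by lra.
have w_all i : w i = (inflow i).[b].
  have [->//|i0] := eqVneq i ord0; have [->//|si] := eqVneq i s.
  have [/wU//|iU] := boolP (i \in U).
  by apply: wL; rewrite (mem_L hadm) i0 si.
have o_all i : o i = (outflow i).[b].
  have [->//|i0] := eqVneq i ord0; exact: oE.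
pose a i := x i (pi i); pose c i := x i (pi (ord_pred i)).
have oac i : (outflow i).[b] = a i + c i by rewrite -o_all /o flowE flow_out.
have wac i : (inflow (pi i)).[b] = a i + c (ordS i) by rewrite -w_all /w flowE flow_in.
have cs : c s = 0 by rewrite /c (pi_end hadm).
have cS i : c (ordS i) = c i + ((inflow (pi i)).[b] - (outflow i).[b]).
  by rewrite oac wac; ring.
have [_ cE] := arc_sum_unique (s_neq0 hadm) cs cS.
have {}cE i : c i = (excess (ord_pred i)).[b].
  by rewrite cE horner_sum; apply: eq_bigr => j _; rewrite !hornerE.
rewrite /basis_point; congr (_, _).
  rewrite flowE; apply/matrixP => i j; rewrite !mxE -/(a i) -/(c i) -!cE oac.
  by rewrite addrK.
apply/ffunP => i; rewrite ffunE; have [->//|i0] := eqVneq i ord0.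
by rewrite yE // -o_all.
Qed.

End Solution.

End Basis.

(** * First and second order at 1 *)

Section Taylor.
Variables (R : realType) (m : nat).
Implicit Types f g : {poly R}.

Definition slope f : R := f^`().[1].
(** A multiple of the slope is subtracted from the second derivative so that
    the value on ['X^k] vanishes for [k = 0] and [k = m] and is symmetric under
    the exchange of [k] and [m - k]; this cancels most terms of an excess. *)
Definition curv f : R := f^`()^`().[1] - (m%:R - 1) * slope f.

Lemma slopeD f g : slope (f + g) = slope f + slope g.
Proof. by rewrite /slope derivD hornerD. Qed.
Lemma slopeN f : slope (- f) = - slope f.
Proof. by rewrite /slope derivN hornerN. Qed.
Lemma slopeMn f k : slope (f *+ k) = slope f *+ k.
Proof. by rewrite /slope derivMn hornerMn. Qed.
Lemma slope_sum I r (P : pred I) (F : I -> {poly R}) :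
  slope (\sum_(i <- r | P i) F i) = \sum_(i <- r | P i) slope (F i).
Proof. by rewrite /slope raddf_sum horner_sum. Qed.
Lemma slopeXn k : slope 'X^k = k%:R.
Proof. by rewrite /slope derivXn hornerMn hornerXn expr1n. Qed.

Lemma curvD f g : curv (f + g) = curv f + curv g.
Proof. by rewrite /curv slopeD !derivD hornerD; ring. Qed.
Lemma curvN f : curv (- f) = - curv f.
Proof. by rewrite /curv slopeN !derivN hornerN; ring. Qed.
Lemma curvMn f k : curv (f *+ k) = curv f *+ k.
Proof. by rewrite /curv slopeMn !derivMn hornerMn mulrnAr mulrnBl. Qed.
Lemma curv_sum I r (P : pred I) (F : I -> {poly R}) :
  curv (\sum_(i <- r | P i) F i) = \sum_(i <- r | P i) curv (F i).
Proof.
by rewrite /curv slope_sum !raddf_sum horner_sum /= mulr_sumr -sumrB.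
Qed.
Lemma curvXn k : curv 'X^k = k%:R * (k%:R - m%:R).
Proof.
rewrite /curv slopeXn derivXn derivMn derivXn !hornerMn hornerXn expr1n.
case: k => [|k] /=; first by rewrite mulr0n mul0r mulr0 subr0.
by rewrite -[in X in X - _]mulr_natr -natr1; ring.
Qed.

Lemma slopeX : slope 'X = 1. Proof. exact: slopeXn 1. Qed.
Lemma slope1 : slope 1 = 0. Proof. exact: slopeXn 0. Qed.
Lemma curvX : curv 'X = 1 - m%:R.
Proof. exact: etrans (curvXn 1) (mul1r _). Qed.
Lemma curv1 : curv 1 = 0.
Proof. exact: etrans (curvXn 0) (mul0r _). Qed.

Lemma sum_ord_succ k : (\sum_(j < k) (j.+1)%:R) *+ 2 = k%:R * (k%:R + 1) :> R.
Proof.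
elim: k => [|k IH]; first by rewrite big_ord0 mul0rn mul0r.
by rewrite big_ord_recr /= mulrnDl IH -natr1; ring.
Qed.

Lemma sum_ord_succ_mul k (x : R) :
  (\sum_(j < k) (j.+1)%:R * ((j.+1)%:R - x)) *+ 6
  = k%:R * (k%:R + 1) * (2 * k%:R + 1 - 3 * x).
Proof.
elim: k => [|k IH]; first by rewrite big_ord0 mul0rn !mul0r.
by rewrite big_ord_recr /= mulrnDl IH -natr1; ring.
Qed.

End Taylor.

Section Expansion.
Variables (R : realType) (m : nat).
Variables (s : 'I_m.+1) (pi : {perm 'I_m.+1}) (L U : {set 'I_m.+1}).
Hypothesis hadm : admissible s pi L U.
Local Notation inflow := (inflow R s L U).
Local Notation outflow := (outflow R s L U).
Local Notation excess := (excess R s pi L U).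
Local Notation slope := (@slope R).
Local Notation curv := (@curv R m).

Lemma natr_pred_m : (m.-1)%:R = m%:R - 1 :> R.
Proof. by rewrite -(natrB _ (m_gt0 hadm)) subn1. Qed.

Lemma card_LU_R : #|L|%:R + #|U|%:R = m%:R - 1 :> R.
Proof. by rewrite -natrD -[in RHS](card_LU hadm) -natr1 addrK. Qed.

Lemma outflow_sE : outflow s = \sum_(k < m) 'X^(k.+1) - 'X^m *+ #|L| - 'X *+ #|U|.
Proof.
rewrite (outflow_s R hadm) (inflow_s R hadm) !mulrBr !mulrnAr mulr1 mulr_sumr.
rewrite -exprS prednK ?(m_gt0 hadm) //.
by congr (_ - _ - _); apply: eq_bigr => k _; rewrite exprS.
Qed.

Lemma horner1_inflow_s : (inflow s).[1] = 1.
Proof.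
rewrite (inflow_s R hadm) !hornerE horner_sum.
under eq_bigr do rewrite hornerXn expr1n.
rewrite sumr_const card_ord !hornerMn hornerXn expr1n hornerC.
by have := card_LU_R; lra.
Qed.

Lemma horner1_inflow i : (inflow i).[1] = 1.
Proof.
have [->|i0] := eqVneq i ord0; first by rewrite /inflow eqxx hornerXn expr1n.
have [->|si] := eqVneq i s; first exact: horner1_inflow_s.
by rewrite /inflow (negPf i0) (negPf si); case: ifP; rewrite ?hornerC ?hornerXn ?expr1n.
Qed.

Lemma horner1_outflow i : (outflow i).[1] = 1.
Proof.
by rewrite /outflow; case: ifP; rewrite ?hornerC // hornerM hornerX horner1_inflow mulr1.
Qed.

Lemma horner1_excess i : (excess i).[1] = 0.
Proof.
rewrite /excess /arc_sum horner_sum big1 // => j _.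
by rewrite hornerD hornerN horner1_inflow horner1_outflow subrr.
Qed.

Lemma slope_outflow_s :
  slope (outflow s) *+ 2 = (m%:R - 1) * (m%:R - 2 * #|L|%:R) + 2.
Proof.
rewrite outflow_sE !(slopeD, slopeN, slopeMn, slope_sum, slopeXn).
under eq_bigr do rewrite slopeXn.
rewrite slopeX !mulrnBl sum_ord_succ.
have e := card_LU_R; rewrite -(mulr_natr _ #|L|) -(mulr_natr _ #|U|).
have -> : #|U|%:R = m%:R - 1 - #|L|%:R :> R by rewrite -e; ring.
ring.
Qed.

Lemma curv_outflow_s : curv (outflow s) *+ 6
  = (m%:R - 1) * (6 * #|U|%:R - m%:R * (m%:R + 1)).
Proof.
rewrite outflow_sE !(curvD, curvN, curvMn, curv_sum, curvXn).
under eq_bigr do rewrite curvXn.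
rewrite curvX !mulrnBl sum_ord_succ_mul.
by rewrite -(mulr_natr _ #|L|) -(mulr_natr _ #|U|); ring.
Qed.

Lemma curv_inflow i : i != s -> curv (inflow i) = - (m%:R - 1) * (i \in L)%:R.
Proof.
move=> si; rewrite (mem_L hadm) si /= /inflow (negPf si).
case: (i == ord0) => /=; first by rewrite curvXn subrr !mulr0.
case: (i \in U) => /=; first by rewrite curv1 mulr0.
by rewrite curvXn natr_pred_m; ring.
Qed.

Lemma curv_outflow i : i != s -> curv (outflow i) <= 0.
Proof.
move=> si; have m1 : 1 <= m%:R :> R by rewrite ler1n (m_gt0 hadm).
have [->|i0] := eqVneq i ord0.
  by rewrite /outflow eqxx curv1.
have [iU|iU] := boolP (i \in U).
  by rewrite (outflow_U _ hadm) // curvX; lra.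
by rewrite (outflow_L _ hadm) ?curvXn ?subrr ?mulr0 // (mem_L hadm) i0 si.
Qed.

(** Second order term in a tie.  The nodes of the arc other than [s] have
    nonpositive [curv (outflow j)], and at most [#|L|] of them are sent into
    [L]; the contribution of [s] dominates since
    [m (m + 1) / 6 > #|L| + #|U| = m - 1] for [m >= 4]. *)
Lemma curv_excess_gt0 i : (4 <= m)%N -> i != ord_pred s -> 0 < curv (excess i).
Proof.
move=> m4 ie; have m4R : 4 <= m%:R :> R by rewrite (ler_nat _ 4).
rewrite /excess /arc_sum curv_sum.
under eq_bigr do rewrite curvD curvN.
rewrite big_split sumrN /=.
have s_arc : s \in closed_arc s i.
  have [->|] := eqVneq i s; first by rewrite arc_start set11.
  by case/(arc_cyc_interval (s_neq0 hadm)) => -> _; rewrite setU11.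
have outs : \sum_(j in closed_arc s i) curv (outflow j) <= curv (outflow s).
  rewrite (bigD1 s) //= gerDl sumr_le0 // => j /andP[_]; exact: curv_outflow.
have ins : - (m%:R - 1) * #|L|%:R <= \sum_(j in closed_arc s i) curv (inflow (pi j)).
  under eq_bigr => j ji.
    rewrite curv_inflow; last first.
      rewrite (pi_eq_start hadm); apply: contraTneq ji => ->.
      exact: (end_notin_arc (s_neq0 hadm)).
    over.
  rewrite -mulr_sumr ler_wnM2l //; first lra.
  rewrite -sum1_card natr_sum [leRHS]big_mkcond /=.
  rewrite [leRHS](reindex_inj (@perm_inj _ pi)) /=.
  rewrite big_mkcond /=; apply: ler_sum => j _.
  by do 2?case: ifP => //.
have cs := curv_outflow_s; have cLU := card_LU_R.
have lE : #|L|%:R = m%:R - 1 - #|U|%:R :> R by rewrite -cLU; ring.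
move: ins outs cs; rewrite lE => ins outs cs.
have : 0 < (m%:R - 1) * ((m%:R - 2) * (m%:R - 3)) :> R by rewrite !mulr_gt0 //; lra.
by lra.
Qed.

End Expansion.

(** * Feasibility *)

Section Feasibility.
Variables (R : realType) (m : nat).
Variables (s : 'I_m.+1) (pi : {perm 'I_m.+1}) (L U : {set 'I_m.+1}).
Hypothesis hadm : admissible s pi L U.
Hypothesis m_ge4 : (4 <= m)%N.
Local Notation inflow := (inflow R s L U).
Local Notation outflow := (outflow R s L U).
Local Notation excess := (excess R s pi L U).
Local Notation slope := (@slope R).
Local Notation curv := (@curv R m).

Let m_ge4R : 4 <= m%:R :> R. Proof. by rewrite (ler_nat _ 4). Qed.

Lemma curv_slope0 f : slope f = 0 -> f^`()^`().[1] = curv f.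
Proof. by rewrite /curv => ->; rewrite mulr0 subr0. Qed.

Lemma excess_ge0_near i : i != ord_pred s ->
  (\forall b \near ((1 : R)^'-)%classic, 0 <= (excess i).[b])
    <-> slope (excess i) <= 0.
Proof.
move=> ie; apply: horner_ge0_at_left1 => [|f1]; first exact: horner1_excess hadm _.
by rewrite curv_slope0 //; apply: curv_excess_gt0.
Qed.

Lemma two_slope_outflow_s :
  2 * slope (outflow s) = (m%:R - 1) * (m%:R - 2 * #|L|%:R) + 2.
Proof. by rewrite -(slope_outflow_s R hadm); ring. Qed.

(** Lower bound of [y_s].  In a tie, [2 #|U| = m] and [curv] is negative, so
    the inequality on [#|L|] is strict. *)
Lemma outflow_s_lower_near :
  (\forall b \near ((1 : R)^'-)%classic, 0 <= (outflow s - 'X^m).[b])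
    <-> (m < #|L|.*2 + 2)%N.
Proof.
have m4 := m_ge4R; have m1 : 0 < m%:R - 1 :> R by rewrite subr_gt0; lra.
have c := card_LU_R R hadm; have sl := two_slope_outflow_s.
have -> : (m < #|L|.*2 + 2)%N = (slope (outflow s - 'X^m) < 0).
  rewrite -(ltr_nat R) natrD -mul2n natrM slopeD slopeN slopeXn.
  have e : 2 * (slope (outflow s) - m%:R) = (m%:R - 1) * (m%:R - (2 * #|L|%:R + 2))
    by rewrite mulrBr sl; ring.
  by rewrite -(pmulr_rlt0 (slope _ - _) (ltr0n R 2)) e pmulr_rlt0 ?subr_lt0.
apply: horner_ge0_at_left1_strict => [|f1].
  by rewrite hornerD hornerN (horner1_outflow R hadm) hornerXn expr1n subrr.
rewrite curv_slope0 // curvD curvN curvXn subrr mulr0 subr0.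
have cs := curv_outflow_s R hadm.
have slm : slope (outflow s) = m%:R.
  apply/eqP; rewrite -subr_eq0; move: f1.
  by rewrite -/(slope _) slopeD slopeN slopeXn => ->.
have /eqP : (m%:R - 1) * (m%:R - 2 - 2 * #|L|%:R) = 0 :> R.
  by apply: (addIr (2 * m%:R)); rewrite add0r -[in RHS]slm sl; ring.
rewrite mulf_eq0 => /orP[/eqP|/eqP] h; first lra.
have uE : 2 * #|U|%:R = m%:R :> R by lra.
have : 0 < (m%:R - 1) * (m%:R * (m%:R - 2)) :> R by rewrite !mulr_gt0 //; lra.
move: cs; rewrite (_ : 6 * #|U|%:R = 3 * m%:R :> R); [|lra].
by lra.
Qed.

(** Upper bound of [y_s].  In a tie, [2 #|U| = m - 2] and [curv] is positive,
    so equality is allowed. *)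
Lemma outflow_s_upper_near :
  (\forall b \near ((1 : R)^'-)%classic, 0 <= ('X - outflow s).[b])
    <-> (#|L|.*2 <= m)%N.
Proof.
have m4 := m_ge4R; have m1 : 0 < m%:R - 1 :> R by rewrite subr_gt0; lra.
have c := card_LU_R R hadm; have sl := two_slope_outflow_s.
have -> : (#|L|.*2 <= m)%N = (slope ('X - outflow s) <= 0).
  rewrite -(ler_nat R) -mul2n natrM slopeD slopeN slopeX.
  have e : 2 * (1 - slope (outflow s)) = (m%:R - 1) * (2 * #|L|%:R - m%:R)
    by rewrite mulrBr sl; ring.
  by rewrite -(pmulr_rle0 (_ - slope _) (ltr0n R 2)) e pmulr_rle0 ?subr_le0.
apply: horner_ge0_at_left1 => [|f1].
  by rewrite hornerD hornerN (horner1_outflow R hadm) hornerX subrr.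
rewrite curv_slope0 // curvD curvN curvX.
have cs := curv_outflow_s R hadm.
have slm : slope (outflow s) = 1.
  apply/eqP; rewrite -subr_eq0 -oppr_eq0 opprB; move: f1.
  by rewrite -/(slope _) slopeD slopeN slopeX => ->.
have /eqP : (m%:R - 1) * (m%:R - 2 * #|L|%:R) = 0 :> R.
  by apply: (addIr 2); rewrite -sl slm mulr1 add0r.
rewrite mulf_eq0 => /orP[/eqP|/eqP] h; first lra.
have uE : 2 * #|U|%:R = m%:R - 2 :> R by lra.
have : 0 < (m%:R - 1) * (m%:R * (m%:R - 2)) :> R by rewrite !mulr_gt0 //; lra.
move: cs; rewrite (_ : 6 * #|U|%:R = 3 * m%:R - 6 :> R); [|lra].
by lra.
Qed.

(** The remaining inequalities hold for free near 1: the flow on [(i, pi i)]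
    tends to 1, and the [y_i] with [i != s] are at one of their bounds. *)
Lemma feasible_near : feasible s pi L U R <->
  [/\ \forall b \near ((1 : R)^'-)%classic, 0 <= (outflow s - 'X^m).[b],
      \forall b \near ((1 : R)^'-)%classic, 0 <= ('X - outflow s).[b]
    & forall i, i != ord_pred s ->
        \forall b \near ((1 : R)^'-)%classic, 0 <= (excess i).[b]].
Proof.
split=> [feas|[lower upper exc]].
  have {}feas : \forall b \near ((1 : R)^'-)%classic,
      WH_bounds b (basis_point s pi L U b).
    near=> b.
    have b01 : 0 < b < 1 by near: b; exact: at_left1_itv.
    have [p [bp _]] : exists2 p, unique (basic_solution s pi L U b) p & WH_bounds b p.
      by near: b.
    by rewrite -(basic_solution_unique hadm b01 bp).
  split.
  - move: feas; apply: filterS => b [/(_ s (s_neq0 hadm))] + _.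
    by rewrite ffunE (negPf (s_neq0 hadm)) hornerD hornerN hornerXn => /andP[].
  - move: feas; apply: filterS => b [/(_ s (s_neq0 hadm))] + _.
    rewrite ffunE (negPf (s_neq0 hadm)) hornerD hornerN hornerX => /andP[_].
    by rewrite /= lerD2r subr_ge0.
  - move=> i ie; move: feas; apply: filterS => b [_].
    move=> /(_ (ordS i) (pi i)) /(_ (pi_neq_ordS hadm ie)).
    rewrite mxE ordSK eqxx (inj_eq perm_inj).
    rewrite -(inj_eq (@ord_pred_inj _)) ordSK (negPf (ord_pred_neq hadm i)).
    by rewrite add0r.
have posA : \forall b \near ((1 : R)^'-)%classic,
    forall i, 0 < (outflow i - excess (ord_pred i)).[b].
  apply: filter_forall => i; apply: horner_pos_at_left1.
  by rewrite hornerD hornerN (horner1_outflow R hadm) (horner1_excess R hadm) subr0.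
have excA : \forall b \near ((1 : R)^'-)%classic, forall i, 0 <= (excess i).[b].
  apply: filter_forall => i; have [->|/exc//] := eqVneq i (ord_pred s).
  by rewrite (excess_end R hadm); near=> b; rewrite horner0.
near=> b.
have b01 : 0 < b < 1 by near: b; exact: at_left1_itv.
exists (basis_point s pi L U b).
  split; first exact: basis_point_basic.
  by move=> p /(basic_solution_unique hadm b01).
have /andP[b0 b1] := b01.
have bm : b ^+ m <= b.
  rewrite -[leRHS]expr1; apply: ler_wiXn2l (ltW b0) (ltW b1) _ _ _; exact: m_gt0 hadm.
split.
  move=> i i0; rewrite ffunE (negPf i0) /=.
  have [->|si] := eqVneq i s.
    apply/andP; split; last rewrite lerD2r -subr_ge0.
      have : 0 <= (outflow s - 'X^m).[b] by near: b.
      by rewrite hornerD hornerN hornerXn.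
    have : 0 <= ('X - outflow s).[b] by near: b.
    by rewrite hornerD hornerN hornerX.
  have [iU|iU] := boolP (i \in U).
    by rewrite (outflow_U R hadm iU) hornerX lexx subr_ge0 bm.
  rewrite (outflow_L R hadm) ?hornerXn ?subrr ?lexx ?subr_ge0 ?bm //.
  by rewrite (mem_L hadm) i0 si.
move=> i j ij; rewrite mxE; apply: addr_ge0; case: ifP => // _.
  have : forall i, 0 < (outflow i - excess (ord_pred i)).[b] by near: b.
  by move=> /(_ i) /ltW; rewrite hornerD hornerN.
have : forall i, 0 <= (excess i).[b] by near: b.
exact.
Unshelve. all: by end_near. Qed.

Lemma slope_inflow k : k != s ->
  slope (inflow k) = if k == ord0 then m%:R else if k \in U then 0 else m%:R - 1.
Proof.
move=> ks; rewrite /inflow (negPf ks); case: ifP => _; first exact: slopeXn.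
by case: ifP => _; rewrite ?slope1 ?slopeXn ?(natr_pred_m R hadm).
Qed.

Lemma slope_outflow k : k != s ->
  slope (outflow k) = if k == ord0 then 0 else if k \in U then 1 else m%:R.
Proof.
move=> ks; have [->|k0] := eqVneq k ord0; first by rewrite /outflow eqxx slope1.
have [kU|kU] := boolP (k \in U); first by rewrite (outflow_U R hadm kU) slopeX.
by rewrite (outflow_L R hadm) ?slopeXn // (mem_L hadm) k0 ks.
Qed.

(** The alphas are the first-order coefficients of [inflow (pi j) - outflow j]
    in [1 - b], tabulated by the classes of [j] and [pi j]. *)
Lemma slope_alpha j : j != s -> j != ord_pred s ->
  slope (inflow (pi j) - outflow j) = - (alpha s pi L U j)%:~R.
Proof.
move=> js je; have pis : pi j != s by rewrite (pi_eq_start hadm).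
rewrite slopeD slopeN slope_inflow // slope_outflow //.
have jpi : ~~ ((j == ord0) && (pi j == ord0)).
  by apply/negP => /andP[/eqP-> ]; rewrite (negPf (pi_neq hadm _)).
have U0 k : k \in U -> k != ord0 by move=> kU; case/andP: (U_not_special hadm kU).
move: (U0 j) (U0 (pi j)) jpi.
rewrite /alpha (negPf js) /W !inE js !(mem_L hadm) js pis /=.
by case: (j == ord0); case: (pi j == ord0); case: (j \in U); case: (pi j \in U);
  move=> h1 h2 h3 /=; try (by have := h1 isT); try (by have := h2 isT); try (by []);
  rewrite ?(rmorphB, rmorph1, rmorph0) /= -?pmulrn -?natr1; ring.
Qed.

Lemma slope_alpha_s : #|L| = uphalf (m.+1 - 2) ->
  slope (outflow s) = (alpha s pi L U s)%:~R.
Proof.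
move=> lE; have := two_slope_outflow_s; rewrite /alpha eqxx.
have [mo|me] := boolP (odd m.+1).
  have -> : m%:R = 2 * #|L|%:R :> R by rewrite -natrM; congr _%:R; lia.
  by rewrite subrr mulr0 add0r rmorph1; lra.
have mE : m%:R = 2 * #|L|%:R + 1 :> R by rewrite -natrM natr1; congr _%:R; lia.
have hE : 2 * (m.+1)./2%:R = m%:R + 1 :> R by rewrite -natrM natr1; congr _%:R; lia.
by rewrite -pmulrn mE; move: hE; rewrite mE; lra.
Qed.

Lemma slope_excess_s : slope (excess s) = slope (inflow (pi s)) - slope (outflow s).
Proof. by rewrite /excess /arc_sum arc_start big_set1 slopeD slopeN. Qed.

(** Once [L] has the right size, the slope of [outflow s] is below [m - 1],
    the slope of the inflow on [L], which is itself below that of node 1; on [U]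
    the inflow has slope 0.  The first inequality needs [n >= 5]. *)
Lemma slope_excess_s_le0 : #|L| = uphalf (m.+1 - 2) ->
  slope (excess s) <= 0 <-> pi s \in U.
Proof.
move=> lE; have m4 := m_ge4R; rewrite slope_excess_s slope_inflow ?(pi_neq hadm) //.
have sl := two_slope_outflow_s.
have lm : #|L|%:R * 2 <= m%:R :> R by rewrite -natrM ler_nat; lia.
have ml : m%:R - 1 <= #|L|%:R * 2 :> R by rewrite -natrM lerBlDr natr1 ler_nat; lia.
have sbound : 0 <= slope (outflow s) < m%:R - 1 by apply/andP; split; nra.
have [p0|p0] := eqVneq (pi s) ord0.
  by split; [lra|move=> /(U_not_special hadm); rewrite p0 eqxx].
by case: ifP => _; split=> //; lra.
Qed.

Lemma slope_excess_alpha i : #|L| = uphalf (m.+1 - 2) -> pi s \in U ->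
    i != s -> i != ord_pred s ->
  slope (excess i) =
  - (alpha s pi L U s + \sum_(j in cyc_interval s i) alpha s pi L U j)%:~R.
Proof.
move=> lE piU si ie.
have [arcE s_nin] := arc_cyc_interval (s_neq0 hadm) si.
rewrite /excess (arc_sum_cyc (s_neq0 hadm)) // slopeD slope_sum slopeD slopeN.
rewrite (inflow_U R hadm piU) slope1 sub0r slope_alpha_s //.
rewrite rmorphD rmorph_sum opprD -sumrN; congr (_ + _).
apply: eq_bigr => j ji; apply: slope_alpha.
  by apply: contraTneq ji => ->.
apply: contraTneq ji => ->; have := end_notin_arc (s_neq0 hadm) ie.
by rewrite arcE in_setU1 negb_or => /andP[].
Qed.

End Feasibility.

Theorem theorem4p1 (R : realType) (m : nat) (hn : (5 <= m.+1)%N)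
    (s : 'I_m.+1) (pi : {perm 'I_m.+1}) (L U : {set 'I_m.+1})
    (hadm : admissible s pi L U) :
  feasible s pi L U R <->
  [/\ #|U| = (m.+1 - 2)./2 /\ #|L| = uphalf (m.+1 - 2),
      pi s \in U
    & forall i : 'I_m.+1, i != s -> i != ord_pred s ->
        0 <= alpha s pi L U s + \sum_(j in cyc_interval s i) alpha s pi L U j].
Proof.
have s_end : s != ord_pred s by rewrite eq_sym (ord_pred_neq hadm).
split=> [/(feasible_near _ hadm)[lo up exc]|[cards piU iii]].
  have cards : #|U| = (m.+1 - 2)./2 /\ #|L| = uphalf (m.+1 - 2).
    apply/(card_condition hadm)/andP.
    by split; [apply/(outflow_s_lower_near R hadm hn)
              |apply/(outflow_s_upper_near R hadm hn)].
  have piU : pi s \in U.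
    by apply/(slope_excess_s_le0 R hadm hn cards.2)/(excess_ge0_near R hadm hn)/exc.
  split=> // i si ie.
  have /(excess_ge0_near R hadm hn ie) := exc i ie.
  by rewrite (slope_excess_alpha R hadm hn cards.2 piU si ie) oppr_le0 ler0z.
apply/(feasible_near _ hadm).
have /(card_condition hadm)/andP[lo up] := cards.
split.
- exact/(outflow_s_lower_near R hadm hn).
- exact/(outflow_s_upper_near R hadm hn).
- move=> i ie; apply/(excess_ge0_near R hadm hn ie).
  have [->|si] := eqVneq i s; first exact/(slope_excess_s_le0 R hadm hn cards.2).
  by rewrite (slope_excess_alpha R hadm hn cards.2 piU si ie) oppr_le0 ler0z iii.
Qed.
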